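(* Let $\Gamma((r^S)_{S\subseteq I})$ be a quitting game with $r^i_i=0$ for all $i\in I$, with normal players $I_*=[n]$. If the matrix $\hat R$ is an $M$-matrix, then every vector in $\tilde D:=\mathrm{conv}\{r^1,\dots,r^n\}\cap\mathbb R^N_{\ge0}$ is a sunspot equilibrium payoff.
   Context: A quitting game $\Gamma((r^S)_{S\subseteq I})$: finite player set $I=[N]$, vectors $r^S\in[-1,1]^N$ for all $S\subseteq I$; at each stage each player continues or quits; with $t^*$ the first stage at which some player quits and $S^*$ the set of players quitting then ($S^*=\emptyset$ if nobody ever quits), the payoff is $r^{S^*}$. $r^i:=r^{\{i\}}$. Sunspot version: at each stage the players publicly observe a signal uniform on $[0,1]$, independent of the past; strategies are measurable maps $\xi_i^t:[0,1]^t\to[0,1]$ giving player $i$'s quitting probability at stage $t$ (if nobody quit before) as a function of the signals so far; $\gamma(\xi):=\mathbb E_\xi[r^{S^*}]$; $\xi$ is a sunspot $\varepsilon$-equilibrium if no player can gain more than $\varepsilon$ by deviating to any strategy of the extended game. A vector $x\in\mathbb R^N$ is a sunspot equilibrium payoff if it is the limit, as $\varepsilon\to0$, of payoffs $\gamma(\xi^\varepsilon)$ of sunspot $\varepsilon$-equilibria $\xi^\varepsilon$. Normal players: $I_0:=I$, $I_{l+1}:=\{i\in I_l:\ \exists j\in I_l,\ j\neq i,\ r^j_i\le0\}$, $I_*:=\bigcap_l I_l$; $n:=|I_*|$, players renamed so that $I_*=[n]$. $\hat r^i\in\mathbb R^n$ is the restriction of $r^i$ ($i\in[n]$) to coordinates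 in $I_*$, and $\hat R$ is the $n\times n$ matrix with $i$-th column $\hat r^i$. A $Q$-matrix $R$: for every $q\in\mathbb R^n$ there are $z,w\in\mathbb R^n_{\ge0}$ with $w=q+Rz$ and $z_iw_i=0$ for all $i$. Here an $M$-matrix is a $Q$-matrix (with zero diagonal, as $\hat R$ has) in which every row and every column contains exactly one positive entry. *)

(* Defs.v *)
From HB Require Import structures.
From mathcomp Require Import all_boot all_order all_algebra.
From mathcomp Require Import all_classical all_reals all_analysis.
Set Implicit Arguments. Unset Strict Implicit. Unset Printing Implicit Defensive.
Import Order.TTheory GRing.Theory Num.Theory.
Import numFieldNormedType.Exports.

Local Open Scope ring_scope.

Section QuittingGame.
Variable R : realType.
Variable N : nat.

(* A quitting game: r S j = payoff r^S_j of player j when S is the set of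
   players quitting at the first quitting stage (S = set0: nobody ever quits). *)
Definition game := {set 'I_N} -> 'I_N -> R.

Definition game_bounded (r : game) := forall S j, -1 <= r S j <= 1.

(* A strategy of a player maps a (nonempty) history of public signals
   h = [:: w_1; ...; w_t] (earliest signal first) to the probability of
   quitting at stage t = size h, given that nobody quit before. *)
Definition strat := seq R -> R.
Definition profile := 'I_N -> strat.

Definition is_strategy (s : strat) :=
  (forall t : nat, measurable_fun [set: t.+1.-tuple R]%classic (fun h => s (tval h))) /\
  (forall h, 0 <= s h <= 1).

Definition is_profile (xi : profile) := forall i, is_strategy (xi i).

Definition cont_prob (xi : profile) (h : seq R) : R :=
  \prod_(1 <= k < (size h).+1) \prod_(i : 'I_N) (1 - xi i (take k h)).

Definition stop_prob (xi : profile) (h : seq R) (S : {set 'I_N}) : R :=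
  cont_prob xi (take (size h).-1 h) *
  (\prod_(i in S) xi i h) * (\prod_(i in ~: S) (1 - xi i h)).

Fixpoint iter_unif (T : nat) (f : seq R -> R) : R :=
  match T with
  | 0 => f [::]
  | T'.+1 => Rintegral (@lebesgue_measure R) `[0%R, 1%R]
               (fun w => iter_unif T' (fun h => f (w :: h)))
  end.

Definition payoff_trunc (r : game) (xi : profile) (j : 'I_N) (T : nat) : R :=
  iter_unif T (fun h =>
    \sum_(1 <= k < T.+1) \sum_(S : {set 'I_N} | S != finset.set0)
        stop_prob xi (take k h) S * r S j
    + cont_prob xi h * r finset.set0 j).

(* gamma(xi)_j = E_xi[r^{S*}_j] *)
Definition gamma (r : game) (xi : profile) (j : 'I_N) : R :=
  limn (fun T => payoff_trunc r xi j T).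

Definition deviate (xi : profile) (i : 'I_N) (eta : strat) : profile :=
  fun k => if k == i then eta else xi k.

Definition sunspot_eps_eq (r : game) (eps : R) (xi : profile) :=
  is_profile xi /\
  forall (i : 'I_N) (eta : strat), is_strategy eta ->
    gamma r (deviate xi i eta) i <= gamma r xi i + eps.

Definition sunspot_eq_payoff (r : game) (x : 'I_N -> R) :=
  exists xi : R -> profile,
    (forall eps, 0 < eps -> sunspot_eps_eq r eps (xi eps)) /\
    (forall j, (fun eps => gamma r (xi eps) j) @ 0^'+ --> x j)%classic.

Fixpoint Ilev (r : game) (l : nat) : {set 'I_N} :=
  match l with
  | 0 => [set: 'I_N]
  | l'.+1 => [set i in Ilev r l' |
              [exists j in Ilev r l', (j != i) && (r [set j] i <= 0)]]
  end.

Definition Istar (r : game) : {set 'I_N} :=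
  [set i | `[< forall l, i \in Ilev r l >]].

Definition Rhat (r : game) : 'M[R]_#|Istar r| :=
  \matrix_(k, l) r [set enum_val l] (enum_val k).

Definition Qmatrix n (M : 'M[R]_n) :=
  forall q : 'cV[R]_n, exists z w : 'cV[R]_n,
    [/\ forall k, 0 <= z k 0, forall k, 0 <= w k 0,
        w = q + M *m z & forall k, z k 0 * w k 0 = 0].

Definition Mmatrix n (M : 'M[R]_n) :=
  [/\ Qmatrix M,
      forall k, exists! l, 0 < M k l &
      forall l, exists! k, 0 < M k l].

Definition Dtilde (r : game) (x : 'I_N -> R) :=
  (exists lam : 'I_N -> R,
      [/\ forall i, 0 <= lam i, \sum_(i in Istar r) lam i = 1 &
          forall j, x j = \sum_(i in Istar r) lam i * r [set i] j]) /\
  (forall j, 0 <= x j).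

End QuittingGame.

(* Main.v *)
Require Import Defs.
From HB Require Import structures.
From mathcomp Require Import all_boot all_order all_algebra.
From mathcomp Require Import all_classical all_reals all_analysis.
From mathcomp Require Import ring lra zify.
Set Implicit Arguments. Unset Strict Implicit. Unset Printing Implicit Defensive.
Import Order.TTheory GRing.Theory Num.Theory.
Import numFieldNormedType.Exports.
Local Open Scope ring_scope.

(** Up to a permutation, [Rhat r] is a Z-matrix, and being a Q-matrix makes it
    inverse-nonnegative; hence the polytope [Dtilde] is a simplex whose [k]th
    vertex [y_k] pays zero to every normal player but [k].  At [y_k] the only
    player [p k] with [r^(p k)_k > 0] quits with a small probability [e]: he is
    indifferent (he gets 0 either way), and the continuation payoff
    [(y_k - e r^(p k)) / (1 - e)] lies again in [Dtilde], so the public signal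
    can split it into vertices.  Iterating defines a Markov chain on the
    vertices whose payoffs form a martingale.

    This chain may stay at [y_k] forever (when [r^(p k) = y_k]), and then
    [p k] could block the termination of the game.  So with probability [e^2]
    we move it to a vertex [l] with [l <> k] and [l <> p k], which exists because
    player [k] is normal; this costs at most [e^2 / e] in payoffs and does not
    change the payoff of [p k].  Now no single deviator can prevent termination,
    a deviator who keeps continuing faces a supermartingale up to the error [e],
    and one who quits gains at most [e]. *)

(** * The simplex of normal payoffs *)

(** [p k] is the column of the positive entry in row [k]; injectivity is the uniqueness of the
    positive entry in a column. *)
Lemma Mmatrix_perm (R : realType) n (M : 'M[R]_n) : Mmatrix M ->
  exists p : 'I_n -> 'I_n,
    [/\ injective p, forall k, 0 < M k (p k) &
        forall k l, l != p k -> M k l <= 0].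
Proof.
case=> _ rowP colP.
have /choice[p pP] : forall k, exists l, 0 < M k l /\ forall l', 0 < M k l' -> l = l'.
  by move=> k; have [l [lP lU]] := rowP k; exists l; split.
exists p; split=> [k k' e||k l lp].
- have [m [_ mU]] := colP (p k).
  rewrite -(mU k (pP k).1) -(mU k')// e; exact: (pP k').1.
- by move=> k; exact: (pP k).1.
- rewrite leNgt; apply/negP => /(pP k).2 e.
  by rewrite e eqxx in lp.
Qed.

(* Up to a permutation of its columns [M] is a Z-matrix, and solving the
   complementarity problem for [q = -1] gives [z >= 0] with [M z >= 1]: this is
   the classical characterization of inverse-nonnegative Z-matrices. *)
Lemma Mmatrix_monotone (R : realType) n (M : 'M[R]_n) : Mmatrix M ->
  forall u : 'cV[R]_n, (forall k, 0 <= (M *m u) k 0) -> forall k, 0 <= u k 0.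
Proof.
move=> MM u Mu j.
have [p [pI pP pN]] := Mmatrix_perm MM.
have [QM _ _] := MM.
have [z [w [z0 w0 wE _]]] := QM (const_mx (-1)).
have Mz k : 1 <= (M *m z) k 0.
  by have := w0 k; rewrite wE !mxE; lra.
have surj l : exists k, l = p k by exists (invF pI l); rewrite f_invF.
(* If [z] vanished at [p k], row [k] of [M *m z] would have only nonpositive terms left, against
   [Mz]. *)
have zp l : 0 < z l 0.
  have [k ->] := surj l; rewrite lt_neqAle z0 andbT eq_sym; apply/eqP => zk.
  have := Mz k; rewrite mxE (bigD1 (p k))//= zk mulr0 add0r.
  have : \sum_(i < n | i != p k) M k i * z i 0 <= 0.
    by apply: sumr_le0 => i ip; rewrite mulr_le0_ge0// pN.
  by lra.
rewrite leNgt; apply/negP => uj.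
(* [f m] is the least multiple of [z] that lifts [u] to a nonnegative vector [v]. Since [v] vanishes
   at [m], the row whose positive entry sits at [m] gives [M *m v] a value both positive and at most
   0. *)
pose f i := - u i 0 / z i 0.
have [/= m _ mmax] : {m | xpredT m & forall i, true -> f i <= f m}.
  case: (@arg_maxP _ R 'I_n j xpredT f) => // m _ mP; by exists m => // i _; exact: mP.
have fm : 0 < f m.
  apply: lt_le_trans (mmax j _) => //; rewrite /f divr_gt0// ?oppr_gt0//.
pose v := u + f m *: z.
have v0 i : 0 <= v i 0.
  rewrite !mxE; have := mmax i isT; rewrite {1}/f ler_pdivrMr//; by lra.
have vm : v m 0 = 0.
  by rewrite !mxE /f -mulrA mulVf ?gt_eqF// mulr1 subrr.
have [k mk] := surj m.
have : 0 < (M *m v) k 0.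
  rewrite mulmxDr -scalemxAr mxE [X in _ + X]mxE.
  apply: ltr_wpDl => //; apply: mulr_gt0 => //; exact: lt_le_trans (Mz k).
apply/negP; rewrite -leNgt mxE (bigD1 m)//= vm mulr0 add0r.
by apply: sumr_le0 => i im; rewrite mulr_le0_ge0// pN// -mk.
Qed.

(** Monotonicity applied to [v] and to [- v] shows that a kernel vector is zero. *)
Lemma Mmatrix_unitmx (R : realType) n (M : 'M[R]_n) : Mmatrix M -> M \in unitmx.
Proof.
move=> MM; rewrite -unitmx_tr -row_free_unit -kermx_eq0; apply/eqP/row_matrixP => i.
rewrite row0; have : row i (kermx M^T) *m M^T = 0 by apply/sub_kermxP; rewrite row_sub.
move: (row i _) => v vM.
have Mv : M *m v^T = 0 by rewrite -[LHS]trmxK trmx_mul trmxK vM trmx0.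
apply/matrixP => a b; rewrite (ord1 a) mxE; apply/eqP; rewrite eq_le; apply/andP; split.
  have := @Mmatrix_monotone _ _ _ MM (- v^T) _ b.
  rewrite !mxE oppr_ge0; apply => k.
  by rewrite mulmxN Mv oppr0 mxE.
have := @Mmatrix_monotone _ _ _ MM (v^T) _ b.
by rewrite !mxE; apply => k; rewrite Mv mxE.
Qed.

Lemma Mmatrix_inv_ge0 (R : realType) n (M : 'M[R]_n) : Mmatrix M ->
  forall j k, 0 <= invmx M j k.
Proof.
move=> MM j k; have -> : invmx M j k = (col k (invmx M)) j 0 by rewrite mxE.
apply: (Mmatrix_monotone MM) => l.
by rewrite colE mulmxA mulmxV ?Mmatrix_unitmx// mul1mx mxE ler0n.
Qed.

(* The [lam k] are the vertices of the simplex
   [{u >= 0 | sum u = 1 /\ M u >= 0}]. *)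
Lemma Mmatrix_vertices (R : realType) n (M : 'M[R]_n) : Mmatrix M ->
  exists (lam : 'I_n -> 'cV[R]_n) (c : 'I_n -> R),
    [/\ forall k, 0 < c k,
        forall k j, 0 <= lam k j 0,
        forall k, \sum_j lam k j 0 = 1,
        forall k, M *m lam k = c k *: delta_mx k 0 &
        forall mu : 'cV[R]_n, \sum_j mu j 0 = 1 ->
          (forall l, 0 <= (M *m mu) l 0) ->
          exists pi : 'I_n -> R, [/\ forall l, 0 <= pi l, \sum_l pi l = 1 &
            mu = \sum_l pi l *: lam l]].
Proof.
move=> MM; have MU := Mmatrix_unitmx MM; have inv0 := Mmatrix_inv_ge0 MM.
(* The vertices are the columns of the inverse divided by their sums. A zero sum of nonnegative
   entries would make the column zero. *)
pose s k := \sum_j invmx M j k.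
have s0 k : 0 < s k.
  rewrite lt_neqAle sumr_ge0 ?andbT 1?eq_sym//; apply/eqP => s0.
  have zk j : invmx M j k = 0.
    exact: (@psumr_eq0P _ _ xpredT (fun j => invmx M j k) (fun i _ => inv0 i k) s0 j).
  have : (M *m invmx M) k k = 1 by rewrite mulmxV// mxE eqxx.
  rewrite mxE big1 => [/eqP|i _]; first by rewrite eq_sym oner_eq0.
  by rewrite zk mulr0.
exists (fun k => (s k)^-1 *: col k (invmx M)), (fun k => (s k)^-1); split.
- by move=> k; rewrite invr_gt0.
- by move=> k j; rewrite !mxE mulr_ge0// invr_ge0 ltW.
- move=> k; under eq_bigr do rewrite !mxE.
  by rewrite -mulr_sumr mulVf// gt_eqF.
- by move=> k; rewrite -scalemxAr colE mulmxA mulmxV// mul1mx.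
(* The coordinates come from [mu = invmx M *m (M *m mu)] after rescaling each column to total 1. *)
move=> mu mu1 Mmu0; exists (fun l => s l * (M *m mu) l 0).
have muE : mu = \sum_l (M *m mu) l 0 *: col l (invmx M).
  apply/matrixP => i j; rewrite (ord1 j) summxE -{1}(mul1mx mu) -(mulVmx MU) -mulmxA mxE.
  by apply: eq_bigr => l _; rewrite mulrC [RHS]mxE; congr (_ * _); rewrite mxE.
split=> [l||]; first by rewrite mulr_ge0// ltW.
  rewrite -mu1 {2}muE; under [RHS]eq_bigr do rewrite summxE.
  rewrite exchange_big /=; apply: eq_bigr => l _.
  by rewrite mulr_suml; apply: eq_bigr => j _; rewrite mulrC [RHS]mxE [col l _ j 0]mxE.
rewrite {1}muE; apply: eq_bigr => l _.
by rewrite scalerA mulrAC divff ?gt_eqF// mul1r.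
Qed.

(** * Integration and sampling on the unit interval *)

(* [f] may fail to be measurable: monotonicity holds because the integral of a
   nonnegative function is a supremum over the simple functions below it. *)
Lemma le_Rintegral_sandwich d (T : measurableType d) (R : realType)
    (mu : {measure set T -> \bar R}) (D : set T) (g1 f g2 : T -> R) :
  measurable D ->
  mu.-integrable D (EFin \o g1) -> mu.-integrable D (EFin \o g2) ->
  (forall x, D x -> g1 x <= f x <= g2 x) ->
  Rintegral mu D g1 <= Rintegral mu D f <= Rintegral mu D g2.
Proof.
move=> mD ig1 ig2 gfg.
have pos (u v : T -> \bar R) : (forall x, u x <= v x)%E -> forall x, (u^\+ x <= v^\+ x)%E.
  by move=> uv x; rewrite !funeposE; rewrite ge_max !le_max uv lexx orbT.
have mono (u v : T -> R) : (forall x, D x -> u x <= v x) ->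
    (\int[mu]_(x in D) (u x)%:E <= \int[mu]_(x in D) (v x)%:E)%E.
  move=> uv; rewrite /integral; apply: leeB.
    apply: ereal_sup_le => _ [h hu <-]; exists h => // x.
    apply: (le_trans (hu x)); apply: pos => {}x.
    by rewrite !patchE; case: ifPn => // /set_mem /uv; rewrite lee_fin.
  apply: ereal_sup_le => _ [h hu <-]; exists h => // x.
  apply: (le_trans (hu x)); rewrite -!funeposN; apply: pos => /= {}x.
  by rewrite !patchE leeN2; case: ifPn => // /set_mem /uv; rewrite lee_fin.
have fg1 := integrable_fin_num mD ig1.
have fg2 := integrable_fin_num mD ig2.
have le1 := mono g1 f (fun x Dx => (andP (gfg x Dx)).1).
have le2 := mono f g2 (fun x Dx => (andP (gfg x Dx)).2).
(* [fine] is monotone only between finite values, as it sends both infinities to 0. *)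
have ff : (\int[mu]_(x in D) (f x)%:E)%E \is a fin_num.
  rewrite fin_numE; apply/andP; split; apply/eqP => fE.
    by move: le1; rewrite fE leeNy_eq => /eqP g1E; rewrite /= g1E in fg1.
  by move: le2; rewrite fE leye_eq => /eqP g2E; rewrite /= g2E in fg2.
by rewrite /Rintegral !fine_le.
Qed.

Lemma measurable_fun_finType d (T : measurableType d) (R : realType) (K : finType)
    (phi : T -> K) (f : K -> R) :
  (forall l, measurable (phi @^-1` [set l])%classic) ->
  measurable_fun [set: T]%classic (f \o phi).
Proof.
move=> mphi _ Y _; rewrite setTI.
have -> : ((f \o phi) @^-1` Y = \bigcup_(l in [set l | Y (f l)]) phi @^-1` [set l])%classic.
  by apply/seteqP; split=> [w Yw|w [l Yl /= ->]]; first by exists (phi w).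
by apply: fin_bigcup_measurable => //; exact: finite_finset.
Qed.

Lemma integrable_finType (R : realType) (K : finType) (phi : R -> K) (f : K -> R)
    (D : set R) :
  (forall l, measurable (phi @^-1` [set l])%classic) ->
  measurable D -> (lebesgue_measure D < +oo)%E ->
  (@lebesgue_measure R).-integrable D (EFin \o (f \o phi)).
Proof.
move=> mphi mD Dfin; apply: measurable_bounded_integrable => //.
  by apply: measurable_funTS; exact: measurable_fun_finType.
exists (\sum_l `|f l|); split=> [|M HM w _]; first exact: num_real.
apply: le_trans (ltW HM) => /=.
by rewrite (bigD1 (phi w))//= lerDl sumr_ge0.
Qed.

(** Consecutive half-open intervals of lengths [pi l] are laid out from [a]; [l0] is the value
    outside them. *)
Lemma sample_seq (R : realType) (K : finType) (l0 : K) (pi : K -> R) (s : seq K) :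
  (forall l, 0 <= pi l) -> forall a, exists phi : R -> K,
    [/\ forall l, measurable (phi @^-1` [set l])%classic,
        forall w, phi w = l0 \/ 0 < pi (phi w) &
        forall f : K -> R,
        Rintegral (@lebesgue_measure R) `[a, a + \sum_(l <- s) pi l[%classic (f \o phi) =
        \sum_(l <- s) pi l * f l].
Proof.
move=> pi0; elim: s => [|l s IH] a.
  exists (fun=> l0); split=> [l|w|f]; first by rewrite preimage_cst; case: ifP.
    by left.
  by rewrite !big_nil addr0 set_itvco0 Rintegral_set0.
have [phi [mphi phi0 Hphi]] := IH (a + pi l).
pose psi w := if w \in `[a, a + pi l[ then l else phi w.
have mpsi m : measurable (psi @^-1` [set m])%classic.
  rewrite (_ : (_ @^-1` _ = (`[a, a + pi l[ `&` (cst l @^-1` [set m])) `|`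
    (~` `[a, a + pi l[ `&` (phi @^-1` [set m])))%classic).
    apply: measurableU; apply: measurableI => //; last exact: measurableC.
    by rewrite preimage_cst; case: ifP.
  apply/seteqP; split=> w; rewrite /psi /=.
    by case: ifP => wl e; [left|right]; split=> //; rewrite wl.
  by move=> [[-> //]|[/negP/negbTE ->]].
exists psi; split=> // [w|f].
  rewrite /psi; case: ifP => // /[!in_itv] /= /andP[aw wl]; right.
  by have := le_lt_trans aw wl; rewrite ltrDl.
have s0 : 0 <= \sum_(m <- s) pi m by exact: sumr_ge0.
rewrite !big_cons addrA (@itv_bndbnd_setU _ _ _ (BLeft (a + pi l))) ?bnd_simp ?lerDl//.
rewrite Rintegral_setU //=; last 2 first.
- apply: integrable_finType => //; first exact: measurableU.
  rewrite -itv_bndbnd_setU ?bnd_simp ?lerDl// lebesgue_measure_itv /=.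
  by case: ifP => // _; rewrite -EFinB ltry.
- apply: lt_disjoint => x y; rewrite !in_itv /= => /andP[_ xl] /andP[yl _].
  exact: lt_le_trans xl yl.
congr (_ + _).
  rewrite (@eq_Rintegral _ _ _ _ _ (fun=> f l)) => [|w]; last first.
    by rewrite inE /= /psi => ->.
  rewrite Rintegral_cst//= lebesgue_measure_itv /= lte_fin ltrDl mulrC.
  case: ltP => [_|l0']; first by rewrite -EFinB/= addrAC subrr add0r.
  by rewrite (@le_anti _ _ (pi l) 0) ?l0' ?pi0.
rewrite -Hphi; apply: eq_Rintegral => w.
by rewrite inE /= !in_itv /= /psi in_itv/= => /andP[wl _]; rewrite (ltNge w) wl andbF.
Qed.

(** The support condition holds for every [w], not merely almost every one, so that the chain keeps
    its invariants along all signal histories. For this the default value [l0] is chosen with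
    positive weight. *)
Lemma sample (R : realType) (K : finType) (pi : K -> R) :
  (forall l, 0 <= pi l) -> \sum_l pi l = 1 ->
  exists phi : R -> K,
    [/\ forall l, measurable (phi @^-1` [set l])%classic,
        forall w, 0 < pi (phi w) &
        forall f : K -> R,
        Rintegral (@lebesgue_measure R) `[0%R, 1%R]%classic (f \o phi) =
        \sum_l pi l * f l].
Proof.
move=> pi0 pi1.
have [l0 pil0|pi00] := pickP (fun l => 0 < pi l); last first.
  move: pi1; rewrite big1 => [/eqP|l _]; first by rewrite eq_sym oner_eq0.
  by apply/le_anti; rewrite pi0 andbT leNgt pi00.
have [phi [mphi phi0 Hphi]] := sample_seq l0 (index_enum K) pi0 0.
exists phi; split=> // [w|f]; first by have [->|] := phi0 w.
rewrite -Hphi pi1 add0r Rintegral_itv_bndo_bndc//.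
apply: integrable_finType => //.
by rewrite lebesgue_measure_itv /= lte_fin ltr01 -EFinB ltry.
Qed.

(** * Truncated payoffs *)

Section Recursion.
Variables (R : realType) (N : nat) (r : game R N) (j : 'I_N).
Implicit Types (xi : profile R N) (h : seq R) (w : R).

Definition shift xi w : profile R N := fun i h => xi i (w :: h).

Definition stage_prob (a : 'I_N -> R) (S : {set 'I_N}) : R :=
  (\prod_(i in S) a i) * \prod_(i in ~: S) (1 - a i).

Definition stage_payoff (a : 'I_N -> R) (X : R) : R :=
  \sum_(S : {set 'I_N} | S != finset.set0) stage_prob a S * r S j +
  (\prod_i (1 - a i)) * X.

Definition integrand xi T h : R :=
  \sum_(1 <= k < T.+1) \sum_(S : {set 'I_N} | S != finset.set0)
      stop_prob xi (take k h) S * r S j + cont_prob xi h * r finset.set0 j.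

Lemma cont_prob_cons xi w h :
  cont_prob xi (w :: h) = \prod_i (1 - xi i [:: w]) * cont_prob (shift xi w) h.
Proof.
rewrite /cont_prob /= big_ltn //= take0; congr (_ * _).
by rewrite big_add1 /=.
Qed.

Lemma stop_prob_cons xi w h S : h != [::] ->
  stop_prob xi (w :: h) S =
  \prod_i (1 - xi i [:: w]) * stop_prob (shift xi w) h S.
Proof. by case: h => // v h _; rewrite /stop_prob /= cont_prob_cons !mulrA. Qed.

Lemma stop_prob1 xi w S : stop_prob xi [:: w] S = stage_prob (xi ^~ [:: w]) S.
Proof. by rewrite /stop_prob /= /cont_prob big_geq// mul1r. Qed.

(** Conditioning on the first stage: the rest of the play enters as a continuation payoff, which
    yields a backward recursion in [T]. *)
Lemma integrand_cons xi T w h : size h = T ->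
  integrand xi T.+1 (w :: h) =
  stage_payoff (xi ^~ [:: w]) (integrand (shift xi w) T h).
Proof.
move=> hT; rewrite /integrand /stage_payoff big_ltn//= take0 -addrA; congr (_ + _).
  by apply: eq_bigr => S _; rewrite stop_prob1.
rewrite cont_prob_cons big_add1 /= mulrDr mulrA; congr (_ + _).
rewrite mulr_sumr; apply: eq_big_nat => k /andP[k1 kT].
rewrite mulr_sumr; apply: eq_bigr => S _; rewrite mulrA -stop_prob_cons//.
by rewrite -size_eq0 size_take; case: ifP; rewrite ?hT -lt0n//; lia.
Qed.

Lemma eq_iter_unif T (f g : seq R -> R) :
  (forall h, size h = T -> f h = g h) -> iter_unif T f = iter_unif T g.
Proof.
elim: T f g => [|T IH] f g fg /=; first exact: fg.
apply: eq_Rintegral => w _; apply: IH => h hT; apply: fg => /=; by rewrite hT.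
Qed.

Lemma stage_payoff_affine a b (c : 'I_N -> R) X :
  a + b * stage_payoff c X =
  (a + b * stage_payoff c 0) + (b * \prod_i (1 - c i)) * X.
Proof. by rewrite /stage_payoff; ring. Qed.

Lemma integrable_sample (K : finType) (phi : R -> K) (f : K -> R) :
  (forall l, measurable (phi @^-1` [set l])%classic) ->
  (@lebesgue_measure R).-integrable `[0%R, 1%R]%classic (EFin \o (f \o phi)).
Proof.
move=> mphi; apply: integrable_finType => //.
by rewrite lebesgue_measure_itv /= lte_fin ltr01 -EFinB ltry.
Qed.

(* [Inv xi k] says that the profile [xi] plays the continuation game from the
   state [k] of a Markov chain driven by the signals.  The affine factors [a]
   and [b] carry the stages already played, so that no linearity of integrals
   (hence no measurability of the deviation in [xi]) is needed. *)
Lemma payoff_trunc_sandwich (K : finType) (P : K -> K -> R) (step : K -> R -> K)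
    (Inv : profile R N -> K -> Prop) (Lo Up : nat -> K -> R)
    (Lo' Up' : nat -> K -> R) :
  (forall k, \sum_l P k l = 1) ->
  (forall k l, measurable (step k @^-1` [set l])%classic) ->
  (forall k (f : K -> R),
     Rintegral (@lebesgue_measure R) `[0%R, 1%R]%classic (f \o step k) =
     \sum_l P k l * f l) ->
  (forall k, Lo 0%N k <= r finset.set0 j <= Up 0%N k) ->
  (forall xi k, Inv xi k -> forall w i, 0 <= xi i [:: w] <= 1) ->
  (forall xi k, Inv xi k -> forall w, Inv (shift xi w) (step k w)) ->
  (forall xi k, Inv xi k -> forall T w X, Lo T (step k w) <= X <= Up T (step k w) ->
     Lo' T (step k w) <= stage_payoff (xi ^~ [:: w]) X <= Up' T (step k w)) ->
  (forall T k, Lo T.+1 k <= \sum_l P k l * Lo' T l) ->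
  (forall T k, \sum_l P k l * Up' T l <= Up T.+1 k) ->
  forall T xi k, Inv xi k -> Lo T k <= payoff_trunc r xi j T <= Up T k.
Proof.
move=> P1 mstep stepE base xi01 shiftI stageI LoS UpS T xi k xik.
suff main : forall T a b xi k, Inv xi k -> 0 <= b ->
    a + b * Lo T k <= iter_unif T (fun h => a + b * integrand xi T h) <= a + b * Up T k.
  have := main T 0 1 _ _ xik ler01; rewrite !mul1r !add0r.
  by under eq_iter_unif do rewrite add0r mul1r.
elim=> {T xi k xik} [|T IH] a b xi k xik b0.
  rewrite /= /integrand big_geq// /cont_prob big_geq// add0r mul1r !lerD2l.
  by rewrite !ler_wpM2l//; case/andP: (base k).
have c0 w : 0 <= \prod_i (1 - xi i [:: w]).
  by apply: prodr_ge0 => i _; rewrite subr_ge0; case/andP: (xi01 _ _ xik w i).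
(* [Lo'] and [Up'] hold once the signal of the stage is known, [Lo] and [Up] before it is drawn. *)
have bound w : a + b * Lo' T (step k w) <=
    iter_unif T (fun h => a + b * integrand xi T.+1 (w :: h)) <=
    a + b * Up' T (step k w).
  rewrite (@eq_iter_unif T _ (fun h => (a + b * stage_payoff (xi ^~ [:: w]) 0) +
      (b * \prod_i (1 - xi i [:: w])) * integrand (shift xi w) T h)); last first.
    by move=> h hT; rewrite integrand_cons// stage_payoff_affine.
  have /andP[le1 le2] := IH (a + b * stage_payoff (xi ^~ [:: w]) 0)
    (b * \prod_i (1 - xi i [:: w])) _ _ (shiftI _ _ xik w) (mulr_ge0 b0 (c0 w)).
  (* [stageI] is applied at both end points of this interval, which therefore has to be nonempty. *)
  have LU : Lo T (step k w) <= Up T (step k w).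
    have /andP[l1 l2] := IH 0 1 _ _ (shiftI _ _ xik w) ler01.
    by have := le_trans l1 l2; rewrite !add0r !mul1r.
  apply/andP; split.
    apply: le_trans le1; rewrite -stage_payoff_affine lerD2l ler_wpM2l//.
    have := stageI _ _ xik T w (Lo T (step k w)).
    by rewrite lexx LU => /(_ isT)/andP[].
  apply: (le_trans le2); rewrite -stage_payoff_affine lerD2l ler_wpM2l//.
  have := stageI _ _ xik T w (Up T (step k w)).
  by rewrite lexx LU => /(_ isT)/andP[].
have aff (f : K -> R) : \sum_l P k l * (a + b * f l) = a + b * \sum_l P k l * f l.
  under eq_bigr do rewrite mulrDr mulrCA.
  by rewrite big_split /= -mulr_suml P1 mul1r -mulr_sumr.
have /andP[le1 le2] := @le_Rintegral_sandwich _ _ _ (@lebesgue_measure R)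
  `[0%R, 1%R]%classic ((fun l => a + b * Lo' T l) \o step k)
  (fun w => iter_unif T (fun h => a + b * integrand xi T.+1 (w :: h)))
  ((fun l => a + b * Up' T l) \o step k) (measurable_itv _)
  (integrable_sample _ (mstep k)) (integrable_sample _ (mstep k))
  (fun w _ => bound w).
rewrite !stepE !aff in le1 le2.
apply/andP; split; [apply: le_trans le1|apply: (le_trans le2)];
  by rewrite lerD2l ler_wpM2l.
Qed.
End Recursion.

(** * Stage payoffs with at most two possible quitters *)

Section StagePayoff.
Variables (R : realType) (N : nat) (r : game R N) (j : 'I_N).

Lemma stage_prob0 (a : 'I_N -> R) (S : {set 'I_N}) i : i \in S -> a i = 0 ->
  stage_prob a S = 0.
Proof. by move=> iS ai; rewrite /stage_prob (bigD1 i)//= ai !mul0r. Qed.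

Lemma stage_payoff1 (a : 'I_N -> R) i X : (forall k, k != i -> a k = 0) ->
  stage_payoff r j a X = a i * r [set i] j + (1 - a i) * X.
Proof.
move=> a0; rewrite /stage_payoff; congr (_ + _ * _).
  rewrite (bigD1 [set i])/=; last by apply/set0Pn; exists i; rewrite set11.
  rewrite big1 ?addr0.
    rewrite /stage_prob big_set1 big1 ?mulr1// => k.
    by rewrite !inE => ki; rewrite a0// subr0.
  move=> S /andP[S0 Si].
  have [k kS ki] : exists2 k, k \in S & k != i.
    apply/exists_inP; apply: contraNT Si; rewrite negb_exists_in => /forall_inP H.
    apply/eqP/setP => k; rewrite inE; apply/idP/eqP => [/H/negPn/eqP//|->].
    have /set0Pn[k' k'S] := S0.
    by have /negPn/eqP <- := H _ k'S.
  by rewrite (stage_prob0 kS)// ?a0// mul0r.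
rewrite (bigD1 i)//= big1 ?mulr1// => k ki; by rewrite a0// subr0.
Qed.

(** Arranged by the action of [d], so that a deviator's two pure actions can be bounded separately.
    Every other nonempty set of quitters contains a third player, who surely continues. *)
Lemma stage_payoff2 (a : 'I_N -> R) d i X : i != d ->
  (forall k, k != i -> k != d -> a k = 0) ->
  stage_payoff r j a X =
  (1 - a d) * (a i * r [set i] j + (1 - a i) * X) +
  a d * ((1 - a i) * r [set d] j + a i * r [set d; i] j).
Proof.
move=> id a0; rewrite /stage_payoff.
have id' : d != i by rewrite eq_sym.
have prod2 : \prod_i (1 - a i) = (1 - a d) * (1 - a i).
  rewrite (bigD1 d)//= (bigD1 i)//= big1 ?mulr1// => k /andP[kd ki].
  by rewrite a0// subr0.
rewrite (bigD1 [set d])/=; last by apply/set0Pn; exists d; rewrite set11.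
rewrite (bigD1 [set i])/=; last first.
  apply/andP; split; first by apply/set0Pn; exists i; rewrite set11.
  by apply/eqP => /setP/(_ i); rewrite !inE eqxx (negbTE id).
rewrite (bigD1 [set d; i])/=; last first.
  rewrite -andbA; apply/and3P; split; first by apply/set0Pn; exists i; rewrite !inE eqxx orbT.
    by apply/eqP => /setP/(_ i); rewrite !inE eqxx (negbTE id).
  by apply/eqP => /setP/(_ d); rewrite !inE eqxx (negbTE id').
rewrite big1 ?addr0.
  rewrite prod2 /stage_prob !big_set1 big_setU1 ?inE// big_set1.
  rewrite (bigD1 i)/= ?inE//; rewrite big1; last first.
    move=> k; rewrite !inE => /andP[kd ki]; by rewrite a0// subr0.
  rewrite (bigD1 d)/= ?inE//; rewrite big1; last first.
    move=> k; rewrite !inE => /andP[kd ki]; by rewrite a0// subr0.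
  rewrite big1; last first.
    by move=> k; rewrite !inE negb_or => /andP[kd ki]; rewrite a0// subr0.
  ring.
move=> S /andP[/andP[/andP[S0 Sd] Si] Sdi].
have [k kS /andP[ki kd]] : exists2 k, k \in S & (k != i) && (k != d).
  apply/exists_inP; apply: contraNT Sdi; rewrite negb_exists_in => /forall_inP H.
  have sub k : k \in S -> (k == d) || (k == i).
    by move=> /H; rewrite negb_and !negbK orbC.
  apply/eqP/setP => k; rewrite !inE; apply/idP/idP; first exact: sub.
  move=> /orP[] /eqP ->; apply: contraT => nS.
    suff : S = [set i] by move/eqP; rewrite (negbTE Si).
    apply/eqP; rewrite finset.eqEsubset finset.sub1set; apply/andP; split.
      apply/fintype.subsetP => m mS; rewrite inE; have /orP[/eqP md|//] := sub _ mS.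
      by rewrite md (negbTE nS) in mS.
    have /set0Pn[m mS] := S0; have /orP[/eqP md|/eqP <-//] := sub _ mS.
    by rewrite md (negbTE nS) in mS.
  suff : S = [set d] by move/eqP; rewrite (negbTE Sd).
  apply/eqP; rewrite finset.eqEsubset finset.sub1set; apply/andP; split.
    apply/fintype.subsetP => m mS; rewrite inE; have /orP[//|/eqP md] := sub _ mS.
    by rewrite md (negbTE nS) in mS.
  have /set0Pn[m mS] := S0; have /orP[/eqP <-//|/eqP md] := sub _ mS.
  by rewrite md (negbTE nS) in mS.
by rewrite (stage_prob0 kS)// ?a0// mul0r.
Qed.
End StagePayoff.

(** * Markov chain strategies *)

Section GeometricLimits.
Variable R : realType.
Implicit Types (u : nat -> R) (b C rho : R).

(* A divergent sequence has limit [0] by convention. *)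
Lemma limn_le_geometric u b C rho : 0 <= rho < 1 ->
  (forall T, u T <= b + C * rho ^+ T) -> cvgn u \/ 0 <= b -> limn u <= b.
Proof.
move=> /andP[rho0 rho1] ub; have [cu _|du [//|b0]] := pselect (cvgn u); last first.
  by rewrite (dvgP du).
have cg : ((fun T => b + geometric C rho T) @ \oo --> b)%classic.
  rewrite -[X in (_ --> X)%classic]addr0; apply: cvgD; first exact: cvg_cst.
  by apply: cvg_geometric; rewrite ger0_norm.
rewrite -[leRHS](cvg_lim _ cg)//; apply: ler_lim => //.
  by apply/cvg_ex; exists b.
by apply: nearW.
Qed.

Lemma limn_ge_geometric u b C rho : 0 <= rho < 1 ->
  (forall T, b - C * rho ^+ T <= u T) -> cvgn u -> b <= limn u.
Proof.
move=> rho01 ub cu; rewrite -lerN2 -limN//.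
apply: (@limn_le_geometric _ _ C rho) => // [T|]; last by left; exact: is_cvgN.
by rewrite fctE; have := ub T; lra.
Qed.

Lemma cvgn_geometric_step u C rho : 0 <= rho < 1 ->
  (forall T, `|u T.+1 - u T| <= C * rho ^+ T) -> cvgn u.
Proof.
move=> /andP[rho0 rho1] du.
have -> : u = (fun n => u 0%N + series (telescope u) n).
  by apply/funext => n; exact: eq_sum_telescope.
apply: is_cvgD; first exact: is_cvg_cst.
apply: normed_cvg; apply: (series_le_cvg _ _ _ (@is_cvg_geometric_series _ C rho _)).
- by move=> n; exact: normr_ge0.
- by move=> n; apply: le_trans (du n); exact: normr_ge0.
- by move=> n; exact: du.
- by rewrite ger0_norm.
Qed.
End GeometricLimits.

(** * Payoffs of a Markov chain whose states have one possible quitter each *)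

Section Chain.
Variables (R : realType) (N : nat) (r : game R N).
Hypothesis r_bd : game_bounded r.
Hypothesis r_diag : forall i, r [set i] i = 0.
Variables (K : finType) (P : K -> K -> R) (step : K -> R -> K) (A : pred K).
Variables (q : K -> 'I_N) (y : K -> 'I_N -> R) (e : R).
Hypotheses (e_gt0 : 0 < e) (e_lt1 : e < 1).
Hypothesis P_ge0 : forall k l, 0 <= P k l.
Hypothesis P_sum : forall k, \sum_l P k l = 1.
Hypothesis P_supp : forall k l, ~~ A l -> P k l = 0.
Hypothesis step_meas : forall k l, measurable (step k @^-1` [set l])%classic.
Hypothesis step_supp : forall k w, A (step k w).
Hypothesis step_int : forall k (f : K -> R),
  Rintegral (@lebesgue_measure R) `[0%R, 1%R]%classic (f \o step k) =
  \sum_l P k l * f l.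
Hypothesis y01 : forall l j, 0 <= y l j <= 1.
Hypothesis y_step : forall l j, A l ->
  `|y l j - (e * r [set q l] j + (1 - e) * \sum_m P l m * y m j)| <= e ^+ 2.
Hypothesis y_own : forall l, A l -> \sum_m P l m * y m (q l) <= y l (q l).
(** The next state has a different quitter with probability at least [e ^+ 2], so no single player
    can block termination. *)
Hypothesis leave : forall l, A l -> \sum_(m | q m == q l) P l m <= 1 - e ^+ 2.

(** The signal of a stage moves the state before anybody acts, so the starting state [k] itself is
    never played. *)
Definition chain_profile k : profile R N :=
  fun i h => if i == q (foldl step k h) then e else 0.

Let Y k j := \sum_l P k l * y l j.

Lemma wavg_le k (f g : K -> R) : (forall l, A l -> f l <= g l) ->
  \sum_l P k l * f l <= \sum_l P k l * g l.
Proof.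
move=> fg; apply: ler_sum => l _; have [Al|nA] := boolP (A l).
  by rewrite ler_wpM2l// fg.
by rewrite P_supp// !mul0r.
Qed.

Lemma wavg_cst k c : \sum_l P k l * c = c.
Proof. by rewrite -mulr_suml P_sum mul1r. Qed.

Lemma wavg_norm k (f : K -> R) c : (forall l, A l -> `|f l| <= c) ->
  `|\sum_l P k l * f l| <= c.
Proof.
move=> fc; rewrite ler_norml -[X in X <= _ <= _](wavg_cst k) -[X in _ <= _ <= X](wavg_cst k).
by apply/andP; split; apply: wavg_le => l /fc; rewrite ler_norml => /andP[].
Qed.

Lemma Y01 k j : 0 <= Y k j <= 1.
Proof.
apply/andP; split; first by apply: sumr_ge0 => l _; rewrite mulr_ge0//; case/andP: (y01 l j).
by rewrite -[leRHS](wavg_cst k); apply: wavg_le => l _; case/andP: (y01 l j).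
Qed.

Lemma r_norm S j : `|r S j| <= 1.
Proof. by rewrite ler_norml. Qed.

Fixpoint chain_value j T k : R :=
  if T is T'.+1 then
    \sum_l P k l * (e * r [set q l] j + (1 - e) * chain_value j T' l)
  else r finset.set0 j.

(** The sandwich with equal lower and upper bounds gives an equality. *)
Lemma payoff_trunc_chain j T k :
  payoff_trunc r (chain_profile k) j T = chain_value j T k.
Proof.
apply/eqP; rewrite eq_sym eq_le.
apply: (@payoff_trunc_sandwich _ _ r j K P step (fun xi k => xi = chain_profile k)
  (chain_value j) (chain_value j)
  (fun T l => e * r [set q l] j + (1 - e) * chain_value j T l)
  (fun T l => e * r [set q l] j + (1 - e) * chain_value j T l)) => //.
- by move=> {}k; rewrite lexx.
- by move=> xi {}k -> w i; rewrite /chain_profile; case: ifP => _; [rewrite !ltW|rewrite lexx ler01].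
- by move=> xi {}k -> w.
- move=> xi {}k -> {}T w X /le_anti <-.
  rewrite (@stage_payoff1 _ _ _ _ _ (q (step k w))) /chain_profile /= ?eqxx ?lexx//.
  by move=> i /negbTE ->.
Qed.

Lemma chain_value_bd j T k : `|chain_value j T k| <= 1.
Proof.
have e0 := e_gt0; have e1 := e_lt1.
elim: T k => [|T IH] k /=; first exact: r_norm.
apply: wavg_norm => l _; rewrite (le_trans (ler_normD _ _))// !normrM.
have r1 : e * `|r [set q l] j| <= e by rewrite ler_piMr ?r_norm//; lra.
have v1 : (1 - e) * `|chain_value j T l| <= 1 - e by rewrite ler_piMr//; lra.
by rewrite (@ger0_norm _ e) ?(@ger0_norm _ (1 - e)); lra.
Qed.

(** The play survives each stage with probability [1 - e], so consecutive truncations differ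
    geometrically little. *)
Lemma chain_value_cvg j k : cvgn (chain_value j ^~ k).
Proof.
have e0 := e_gt0; have e1 := e_lt1.
apply: (@cvgn_geometric_step _ _ 2 (1 - e)); first by lra.
move=> T; elim: T k => [|T IH] k.
  rewrite expr0 mulr1 (le_trans (ler_normB _ _))//.
  by have := chain_value_bd j 1 k; have := chain_value_bd j 0 k; lra.
rewrite /= -sumrB; under eq_bigr do rewrite -mulrBr.
apply: wavg_norm => l _.
rewrite opprD addrACA subrr add0r -mulrBr normrM ger0_norm; last by lra.
by rewrite exprS mulrCA ler_wpM2l//; first lra; exact: IH.
Qed.

(** The bound [e] is the fixed point of [x = e ^+ 2 + (1 - e) * x]: an error [e ^+ 2] per stage,
    discounted by survival. *)
Lemma chain_value_near j T k : `|chain_value j T k - Y k j| <= e + 2 * (1 - e) ^+ T.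
Proof.
have e0 := e_gt0; have e1 := e_lt1.
elim: T k => [|T IH] k.
  rewrite expr0 mulr1 (le_trans (ler_normB _ _))//.
  have := chain_value_bd j 0 k; have := Y01 k j => /andP[Y0 Y1].
  by rewrite (ger0_norm Y0); lra.
rewrite /= -sumrB; under eq_bigr do rewrite -mulrBr.
apply: wavg_norm => l Al.
have := y_step j Al; have := IH l; rewrite -/(Y l j) !ler_norml.
have := exprS (1 - e) T; set rT := _ ^+ T => ->.
have rT0 : 0 <= rT by rewrite exprn_ge0//; lra.
move: (chain_value _ _ _) (Y l j) (y l j) => v Yl yl /andP[a1 a2] /andP[b1 b2].
by apply/andP; split; nra.
Qed.

Lemma chain_gamma_near j k : `|gamma r (chain_profile k) j - Y k j| <= e.
Proof.
have e0 := e_gt0; have e1 := e_lt1.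
rewrite /gamma (_ : (fun T => _) = chain_value j ^~ k); last first.
  by apply/funext => T; exact: payoff_trunc_chain.
rewrite ler_norml lerBrDr lerBlDr; apply/andP; split.
  apply: (@limn_ge_geometric _ (chain_value j ^~ k) _ 2 (1 - e)); first by lra.
    2: exact: chain_value_cvg.
  by move=> T; have := chain_value_near j T k; rewrite ler_norml => /andP[]; lra.
apply: (@limn_le_geometric _ _ _ 2 (1 - e)); first by lra.
  by move=> T; have := chain_value_near j T k; rewrite ler_norml => /andP[]; lra.
by left; exact: chain_value_cvg.
Qed.

(** * The payoff of a single deviator [d] *)

Section Deviation.
Variables (d : 'I_N) (k0 : K).

(** The rate has to serve two cases: [1 + e - e ^+ 3 <= rho * (1 + e)] where [d] is the quitter, and
    [(1 - e) * (1 + e) <= rho] elsewhere. *)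
Let rho := 1 - e ^+ 3 / 2.
(* The weight [e] on the states where [d] is the quitter makes [hh] a strict
   Lyapunov function for the survival probability when only [d] deviates. *)
Let hh m : R := 1 + (if q m == d then e else 0).
Let H l := \sum_m P l m * hh m.
(** [U] bounds the deviator's payoff before the next signal and [U'] after it; the geometric term
    pays for plays that outlast the truncation. *)
Let U T k := Y k d + e + rho ^+ T * H k.
Let U' T l := y l d + e + rho ^+ T.+1 * hh l.

Let hh_bd m : 1 <= hh m <= 1 + e.
Proof.
have e0 := e_gt0; have e1 := e_lt1.
 by rewrite /hh; case: ifP => _; apply/andP; split; lra. Qed.

Let H_bd l : 1 <= H l <= 1 + e.
Proof.
rewrite -[X in X <= _ <= _](wavg_cst l) -[X in _ <= _ <= X](wavg_cst l).
by apply/andP; split; apply: wavg_le => m _; case/andP: (hh_bd m).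
Qed.

Let H_own l : A l -> q l = d -> H l <= 1 + e * (1 - e ^+ 2).
Proof.
have e0 := e_gt0; have e1 := e_lt1.
move=> Al qd; rewrite /H /hh.
under eq_bigr do rewrite mulrDr mulr1.
rewrite big_split /= P_sum lerD2l.
under eq_bigr do rewrite (fun_if ( *%R (P l _))) mulr0.
rewrite -big_mkcond /= -mulr_suml mulrC ler_wpM2l//; first lra.
by have := leave Al; rewrite qd.
Qed.

Let rho01 : 0 <= rho < 1.
Proof.
have e0 := e_gt0; have e1 := e_lt1.
have e3 : 0 < e ^+ 3 <= 1 by rewrite exprn_gt0 ?exprn_ile1//; lra.
by rewrite /rho; lra.
Qed.

Lemma gamma_deviate_le (eta : strat R) : (forall h, 0 <= eta h <= 1) ->
  gamma r (deviate (chain_profile k0) d eta) d <= Y k0 d + e.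
Proof.
have e0 := e_gt0; have e1 := e_lt1.
move=> eta01; apply: (@limn_le_geometric _ _ _ (H k0) rho) => //; last first.
  (* Convergence under a deviation is not established; the default limit 0 also respects the
     nonnegative bound. *)
  by right; have := Y01 k0 d; lra.
have rho0 : 0 <= rho by case/andP: rho01.
move=> T; rewrite (mulrC (H k0)).
suff /andP[_] : -1 <= payoff_trunc r (deviate (chain_profile k0) d eta) d T <= U T k0.
  by [].
apply: (@payoff_trunc_sandwich _ _ r d K P step
  (fun xi k => exists2 eta : strat R, (forall h, 0 <= eta h <= 1) &
     xi = deviate (chain_profile k) d eta)
  (fun _ _ => -1) U (fun _ _ => -1) U') => //.
- move=> k; case/andP: (r_bd finset.set0 d) => -> r1 /=.
  rewrite /U expr0 mul1r; have := H_bd k; have := Y01 k d; lra.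
- move=> xi k [t t01 ->] w i; rewrite /deviate /chain_profile; case: ifP => // _.
  by case: ifP => _; [rewrite !ltW|rewrite lexx ler01].
- move=> xi k [t t01 ->] w; exists (fun h => t (w :: h)) => //.
  by apply/funext => i; apply/funext => h; rewrite /shift /deviate; case: ifP.
- move=> xi k [t t01 ->] {}T w X /andP[X1 XU].
  set l := step k w in XU *; have Al : A l by exact: step_supp.
  have /andP[t0 t1] := t01 [:: w].
  have rT0 : 0 <= rho ^+ T by rewrite exprn_ge0.
  have /andP[yl0 yl1] := y01 l d.
  have /andP[Hl1 Hl2] := H_bd l.
  (* Where [d] is the quitter, quitting pays 0 and continuing is controlled by [y_own] and the
     Lyapunov weight. *)
  have [qd|qd] := eqVneq (q l) d.
    rewrite (@stage_payoff1 _ _ _ _ _ d); last first.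
      by move=> i id; rewrite /deviate (negbTE id) /chain_profile /= -/l qd (negbTE id).
    rewrite r_diag mulr0 add0r /deviate eqxx.
    have XU' : X <= U' T l.
      apply: (le_trans XU); rewrite /U /U' /hh qd eqxx exprSr -mulrA.
      apply: lerD; first by rewrite lerD2r -qd y_own.
      rewrite ler_wpM2l//; apply: (le_trans (H_own Al qd)); rewrite /rho.
      have e3 : e ^+ 3 * e <= e ^+ 3 by rewrite ler_piMr ?exprn_ge0//; lra.
      by lra.
    have U0 : 0 <= U' T l.
      rewrite /U' !addr_ge0 ?mulr_ge0 ?exprn_ge0//; first lra.
      by have := hh_bd l; lra.
    by apply/andP; split; nra.
  (* Elsewhere, if [d] quits, the payoff is 0 alone and at most 1 jointly with [q l], hence at most
     [e] on average; if [d] continues, [y_step] applies and [e ^+ 2 + (1 - e) * e = e]. *)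
  rewrite (@stage_payoff2 _ _ _ _ _ d (q l))//; last first.
    move=> i iq id; by rewrite /deviate (negbTE id) /chain_profile /= -/l (negbTE iq).
  rewrite /deviate (negbTE qd) eqxx /chain_profile /= -/l eqxx r_diag mulr0 add0r.
  have /andP[r1 r2] := r_bd [set q l] d.
  have /andP[rr1 rr2] := r_bd [set d; q l] d.
  apply/andP; split.
    set a := e * _ + _; have a1 : -1 <= a by rewrite /a; nra.
    set b := e * _; have b1 : -1 <= b by rewrite /b; nra.
    by nra.
  have : e * r [set q l] d + (1 - e) * X <= U' T l.
    have XU2 : (1 - e) * X <= (1 - e) * U T l by rewrite ler_wpM2l//; lra.
    have := y_step d Al; rewrite -/(Y l d) ler_norml => /andP[ys _].
    have rS : (1 - e) * (rho ^+ T * H l) <= rho ^+ T.+1 * hh l.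
      rewrite /hh (negbTE qd) addr0 mulr1 exprSr mulrCA ler_wpM2l//.
      apply: (@le_trans _ _ ((1 - e) * (1 + e))); first by rewrite ler_wpM2l//; lra.
      rewrite /rho; have : e ^+ 3 <= e ^+ 2 by rewrite [leLHS]exprS ler_piMl ?exprn_ge0//; lra.
      have : 0 <= e ^+ 2 by rewrite exprn_ge0//; lra.
      by rewrite !expr2; lra.
    rewrite expr2 in ys; move: XU2 rS; rewrite /U /U'.
    move: (rho ^+ T * H l) (rho ^+ T.+1 * hh l) => a b XU2 rS; lra.
  have : e * r [set d; q l] d <= U' T l.
    have : 0 <= rho ^+ T.+1 * hh l.
      by rewrite mulr_ge0 ?exprn_ge0//; have := hh_bd l; lra.
    rewrite /U'; have : e * r [set d; q l] d <= e by rewrite ler_piMr//; lra.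
    lra.
  move: (U' T l) (e * _ + _) (e * _) => c a b bc ac; nra.
- by move=> {}T k; rewrite wavg_cst.
- move=> {}T k; rewrite /U /U'; under eq_bigr do rewrite mulrDr mulrDr mulrCA.
  by rewrite !big_split /= wavg_cst -mulr_sumr -/(Y k d) -/(H k).
- by exists eta.
Qed.

End Deviation.
End Chain.

(** * Normal players *)

Section NormalPlayers.
Variables (R : realType) (N : nat) (r : game R N).

Lemma Ilev_sub l m : (l <= m)%N -> {subset Ilev r m <= Ilev r l}.
Proof.
move=> /subnK <-; elim: (m - l)%N => [|k IH] i //=.
by rewrite inE => /andP[/IH].
Qed.

Lemma IstarP i : reflect (forall l, i \in Ilev r l) (i \in Istar r).
Proof. by rewrite inE; apply: (iffP (asboolP _)). Qed.

(** The levels decrease, so the largest of the finitely many exit levels will do. *)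
Lemma Istar_Ilev : exists L, Ilev r L = Istar r.
Proof.
have lev i : exists l, i \notin Istar r -> i \notin Ilev r l.
  have [iI|/IstarP/existsNP[l /negP il]] := boolP (i \in Istar r); last by exists l.
  by exists 0%N.
have {lev} [f fP] := choice lev.
exists (\max_i f i); apply/setP => i; apply/idP/idP => [|/IstarP//].
apply: contraTT => /fP; apply: contra; apply: Ilev_sub.
exact: leq_bigmax.
Qed.

Lemma Istar_threat i : i \in Istar r ->
  exists2 j, j \in Istar r & j != i /\ r [set j] i <= 0.
Proof.
move=> /IstarP iI; have [L LE] := Istar_Ilev.
have := iI L.+1; rewrite /= LE inE => /andP[_ /exists_inP[j jI /andP[ji rj]]].
by exists j.
Qed.

(** At the level where [i] is eliminated, every other remaining player, and so every normal one,
    pays [i] a positive amount. *)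
Lemma notin_Istar_gt0 i j : i \notin Istar r -> j \in Istar r -> 0 < r [set j] i.
Proof.
move=> iN jI; have ij : j != i by apply: contraNneq iN => <-.
have /IstarP/existsNP[l /negP] := iN.
elim: l => [|l IH]; first by rewrite inE.
have [il|/IH//] := boolP (i \in Ilev r l).
rewrite /= inE il /= negb_exists_in => /forall_inP/(_ j).
by move/IstarP: jI => /(_ l) -> /(_ isT); rewrite ij /= -ltNge.
Qed.
End NormalPlayers.

(** * Measurability of the chain strategies *)

Lemma measurable_foldl d (T : measurableType d) (K : finType) (step : K -> T -> K) :
  (forall k l, measurable (step k @^-1` [set l])%classic) ->
  forall t k l, measurable
    ((fun h : t.-tuple T => foldl step k (tval h)) @^-1` [set l])%classic.
Proof.
move=> mstep; elim=> [|t IH] k l.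
  rewrite (_ : (fun h : 0.-tuple T => _) = cst k); last first.
    by apply/funext => h; rewrite (tuple0 h).
  by rewrite preimage_cst; case: ifP.
rewrite (_ : (_ @^-1` _)%classic = (\bigcup_(m in [set: K])
  (((fun h : t.+1.-tuple T => tnth h ord0) @^-1` (step k @^-1` [set m])) `&`
   ((fun h : t.+1.-tuple T => [tuple of behead h]) @^-1`
     ((fun h : t.-tuple T => foldl step m (tval h)) @^-1` [set l]))))%classic).
  apply: fin_bigcup_measurable => [|m _]; first exact: finite_finset.
  apply: measurableI.
    by rewrite -[X in measurable X]setTI; exact: measurable_tnth.
  by rewrite -[X in measurable X]setTI; apply: measurable_behead => //; exact: IH.
apply/seteqP; split=> h.
  case/tupleP: h => w h /= hl; exists (step k w) => //.
case/tupleP: h => w h [m _] /= [<-].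
by [].
Qed.

Lemma chain_profile_is_profile (R : realType) N (K : finType) (step : K -> R -> K)
    (q : K -> 'I_N) (e : R) k :
  0 <= e <= 1 -> (forall k l, measurable (step k @^-1` [set l])%classic) ->
  is_profile (chain_profile step q e k).
Proof.
move=> e01 mstep i; split=> [t|h]; last first.
  by rewrite /chain_profile; case: ifP => // _; rewrite lexx ler01.
exact: (@measurable_fun_finType _ _ _ _ _ (fun l => if i == q l then e else 0)
  (fun l => @measurable_foldl _ _ _ _ mstep t.+1 k l)).
Qed.

Lemma big_option_sum (V : nmodType) (I : finType) (F : option I -> V) :
  \sum_l F l = F None + \sum_i F (Some i).
Proof.
rewrite (bigD1 None)//= (reindex_omap Some id) /=; last by case.
by congr (_ + _); apply: eq_bigl => i; rewrite eqxx.
Qed.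

(** * The equilibrium *)

Section Assembly.
Variables (R : realType) (N : nat) (r : game R N).
Hypothesis r_bd : game_bounded r.
Hypothesis r_diag : forall i, r [set i] i = 0.
Hypothesis rM : Mmatrix (Rhat r).

Local Notation n := #|Istar r|.
Local Notation player := (@enum_val _ (mem (Istar r))).

Lemma sum_Istar (F : 'I_N -> R) :
  \sum_(i in Istar r) F i = \sum_k F (player k).
Proof. exact: big_enum_val. Qed.

(** Payoff, to any player of the game, when a single normal quitter is drawn with weights [mu]. *)
Definition mix (mu : 'cV[R]_n) (j : 'I_N) : R :=
  \sum_i mu i 0 * r [set player i] j.

Lemma mix_Rhat mu l : mix mu (player l) = (Rhat r *m mu) l 0.
Proof. by rewrite /mix mxE; apply: eq_bigr => i _; rewrite !mxE mulrC. Qed.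

Lemma mixD mu nu j : mix (mu + nu) j = mix mu j + mix nu j.
Proof. by rewrite -big_split; apply: eq_bigr => i _; rewrite mxE mulrDl. Qed.

Lemma mixZ a mu j : mix (a *: mu) j = a * mix mu j.
Proof. by rewrite mulr_sumr; apply: eq_bigr => i _; rewrite mxE mulrA. Qed.

Lemma mix_sum (I : finType) (F : I -> 'cV[R]_n) j :
  mix (\sum_i F i) j = \sum_i mix (F i) j.
Proof.
rewrite /mix exchange_big /=; apply: eq_bigr => i _.
by rewrite summxE mulr_suml.
Qed.

Lemma mix_delta i j : mix (delta_mx i 0) j = r [set player i] j.
Proof.
rewrite /mix (bigD1 i)//= mxE !eqxx mul1r big1 ?addr0// => k ki.
by rewrite mxE (negbTE ki) mul0r.
Qed.

(** Nonnegativity has to be checked for normal players only: the others get positive payoffs by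
    [notin_Istar_gt0]. *)
Lemma mix_bd (mu : 'cV[R]_n) j : (forall i, 0 <= mu i 0) -> \sum_i mu i 0 = 1 ->
  (forall l, 0 <= (Rhat r *m mu) l 0) -> 0 <= mix mu j <= 1.
Proof.
move=> mu0 mu1 Mmu; apply/andP; split; last first.
  rewrite -mu1; apply: ler_sum => i _; rewrite ler_piMr//.
  by case/andP: (r_bd [set player i] j).
have [jI|jN] := boolP (j \in Istar r).
  by rewrite -(enum_rankK_in jI jI) mix_Rhat.
apply: sumr_ge0 => i _; rewrite mulr_ge0// ltW//.
by apply: notin_Istar_gt0 => //; exact: enum_valP.
Qed.

Lemma sunspot_approx (x : 'I_N -> R) eps : Dtilde r x -> 0 < eps ->
  exists xi : profile R N,
    sunspot_eps_eq r eps xi /\ forall j, `|gamma r xi j - x j| <= eps.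
Proof.
move=> [[w [w0 w1 xE]] x0] eps0.
have [p [pI pP pN]] := Mmatrix_perm rM.
have [lam [c [c0 lam0 lam1 lamE decomp]]] := Mmatrix_vertices rM.
have pk k : p k != k.
  by apply/eqP => e; have := pP k; rewrite e mxE r_diag ltxx.
have /choice[jump jumpP] : forall k, exists l, l != k /\ l != p k.
  move=> k; have [j jI [jk rj]] := Istar_threat (enum_valP k).
  exists (enum_rank_in jI j); split.
    by apply: contraNneq jk => <-; rewrite enum_rankK_in.
  apply/eqP => e; have := pP k; rewrite -e mxE enum_rankK_in//.
  by rewrite ltNge rj.
pose yv k := mix (lam k).
have yv01 k j : 0 <= yv k j <= 1.
  apply: mix_bd => // l; rewrite lamE !mxE mulr_ge0 ?ler0n//; exact: ltW.
have yvE k l : yv k (player l) = c k * (l == k)%:R.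
  by rewrite /yv mix_Rhat lamE !mxE eqxx andbT.
(* [e <= c k] keeps the continuation payoff of player [k] nonnegative; [e <= eps / 2] covers the
   error [e] in the payoff plus the gain [e] of a deviator. *)
pose e := Num.min (Num.min (1 / 2) (eps / 2)) (\big[Num.min/1]_k c k).
have e0 : 0 < e by rewrite !lt_min lt_bigmin// !divr_gt0.
have e1 : e < 1 by rewrite /e !gt_min ltr_pdivrMr// mul1r ltr1n.
have eeps : e <= eps / 2 by rewrite /e !ge_min lexx orbT.
have ec k : e <= c k by rewrite /e ge_min bigmin_le orbT.
have /choice[P0 P0P] : forall k, exists pi : 'I_n -> R,
    [/\ forall l, 0 <= pi l, \sum_l pi l = 1 &
        forall j, yv k j = e * r [set player (p k)] j + (1 - e) * \sum_l pi l * yv l j].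
  move=> k.
  have e1' : 1 - e != 0 by rewrite subr_eq0 gt_eqF.
  (* The continuation left after [p k] has quit with probability [e]. In coordinate [k] it is
     nonnegative by [ec]; in another coordinate [l] the vertex pays 0 and [p k] pays at most 0, as
     [p l != p k]. *)
  pose mu := (1 - e)^-1 *: (lam k - e *: delta_mx (p k) 0).
  have [||pi [pi0 pi1 muE]] := decomp mu.
  - under eq_bigr do rewrite !mxE.
    rewrite -mulr_sumr sumrB lam1 -mulr_sumr (bigD1 (p k))//= !eqxx big1 ?addr0 ?mulr1 ?mulVf//.
    by move=> i /negbTE ->.
  - move=> l; rewrite -mix_Rhat /mu mixZ mulr_ge0 ?invr_ge0 ?subr_ge0 ?(ltW e1)//.
    rewrite -scaleNr mixD mixZ mix_delta -/(yv k) yvE.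
    have [->|lk] := eqVneq l k.
      rewrite mulr1 mulNr subr_ge0 (le_trans _ (ec k))// ler_piMr ?(ltW e0)//.
      by have /andP[] := r_bd [set player (p k)] (player k).
    rewrite mulr0 add0r mulNr oppr_ge0 mulr_ge0_le0 ?(ltW e0)//.
    have := pN l (p k); rewrite mxE; apply; apply: contraNneq lk => /pI ->.
    by rewrite eqxx.
  exists pi; split=> // j.
  have <- : mix mu j = \sum_l pi l * yv l j.
    by rewrite muE mix_sum; apply: eq_bigr => l _; rewrite mixZ.
  rewrite /mu mixZ mulrA divff// mul1r -scaleNr mixD mixZ mix_delta -/(yv k).
  by rewrite mulNr addrC subrK.
pose lam_x : 'cV[R]_n := \col_k w (player k).
have xmix j : x j = mix lam_x j.
  by rewrite xE sum_Istar; apply: eq_bigr => i _; rewrite mxE.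
have [||px [px0 px1 pxE]] := decomp lam_x.
- by rewrite -w1 sum_Istar; apply: eq_bigr => i _; rewrite mxE.
- by move=> l; rewrite -mix_Rhat -xmix.
have xpx j : x j = \sum_l px l * yv l j.
  by rewrite xmix pxE mix_sum; apply: eq_bigr => l _; rewrite mixZ.
(* A dummy quitter for the initial state. *)
have [i0 _] : exists i0 : 'I_N, i0 \in Istar r.
  apply/existsP; rewrite -[X in is_true X]negbK negb_exists; apply/negP => /forallP H.
  by move: w1; rewrite big_pred0 => [/eqP|i]; [rewrite eq_sym oner_eq0|exact/negbTE].
(* [None] is an initial state that is never entered again; from it the first signal draws a vertex
   with the barycentric weights [px] of [x]. *)
pose P (k l : option 'I_n) : R :=
  match k, l with
  | _, None => 0
  | None, Some l => px l
  | Some k, Some l => (1 - e ^+ 2) * P0 k l + e ^+ 2 * (l == jump k)%:R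
  end.
pose q (k : option 'I_n) := if k is Some k then player (p k) else i0.
pose y (k : option 'I_n) j := if k is Some k then yv k j else 0.
have e2 : 0 <= e ^+ 2 <= 1 by rewrite exprn_ge0 ?exprn_ile1 ?ltW.
have e2' : 0 <= 1 - e ^+ 2 by rewrite subr_ge0; case/andP: e2.
have sumP k (f : option 'I_n -> R) : \sum_l P (Some k) l * f l =
    (1 - e ^+ 2) * (\sum_l P0 k l * f (Some l)) + e ^+ 2 * f (Some (jump k)).
  rewrite big_option_sum /= mul0r add0r.
  under eq_bigr do rewrite mulrDl -mulrA.
  rewrite big_split /= -mulr_sumr; congr (_ + _).
  rewrite (bigD1 (jump k))//= eqxx mulr1 big1 ?addr0// => l /negbTE ->.
  by rewrite mulr0 mul0r.
have P_ge0 k l : 0 <= P k l.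
  case: k l => [k|] [l|] //=.
  by have [P00 _ _] := P0P k; rewrite addr_ge0// mulr_ge0//; case/andP: e2.
have P_sum k : \sum_l P k l = 1.
  case: k => [k|]; last by rewrite big_option_sum /= add0r.
  have := sumP k (fun=> 1); under eq_bigr do rewrite mulr1.
  move=> ->; under eq_bigr do rewrite mulr1.
  by have [_ -> _] := P0P k; rewrite !mulr1 subrK.
have [step stepP] := choice (fun k => sample (P_ge0 k) (P_sum k)).
have step_meas k l : measurable (step k @^-1` [set l])%classic by case: (stepP k).
have step_int k := let: And3 _ _ H := stepP k in H.
have P_supp k (l : option 'I_n) : ~~ isSome l -> P k l = 0 by case: l; case: k.
have step_supp k v : isSome (step k v).
  have [_ + _] := stepP k => /(_ v); apply: contraTT => /P_supp ->.
  by rewrite ltxx.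
have y01 l j : 0 <= y l j <= 1 by case: l => [l|] //=; rewrite lexx ler01.
have y_step l j : isSome l ->
  `|y l j - (e * r [set q l] j + (1 - e) * \sum_m P l m * y m j)| <= e ^+ 2.
  case: l => // k _ /=; rewrite (sumP k (y ^~ j)) /=.
  have [P00 P01 /(_ j) ->] := P0P k.
  set S := \sum_l _.
  have /andP[S0 S1] : 0 <= S <= 1.
    apply/andP; split.
      by apply: sumr_ge0 => l _; rewrite mulr_ge0//; case/andP: (yv01 l j).
    rewrite -P01; apply: ler_sum => l _; rewrite ler_piMr//.
    by case/andP: (yv01 l j).
  have /andP[t0 t1] := yv01 (jump k) j.
  rewrite (_ : _ - _ = e ^+ 2 * ((1 - e) * (S - yv (jump k) j))); last by ring.
  rewrite normrM ger0_norm ?exprn_ge0 ?(ltW e0)// ler_piMr ?exprn_ge0 ?(ltW e0)//.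
  rewrite normrM mulr_ile1//; last by rewrite ler_norml; apply/andP; split; lra.
  by rewrite ger0_norm; lra.
(* Both sides are 0: vertex [k] pays nothing to [p k], who gets 0 by quitting, so the split average
   is 0 too, and [jump k != p k]. *)
have y_own l : isSome l -> \sum_m P l m * y m (q l) <= y l (q l).
  case: l => // k _; rewrite (sumP k (y ^~ _)) /= !yvE.
  have [_ _ /(_ (player (p k)))] := P0P k.
  rewrite yvE (negbTE (pk k)) !mulr0 r_diag mulr0 add0r => /esym/eqP.
  rewrite mulf_eq0 subr_eq0 gt_eqF//= => /eqP ->.
  by rewrite eq_sym (negbTE (jumpP k).2) !mulr0 addr0.
(* As [p] is injective, only state [k] shares its quitter, and [jump k] differs from [k]. *)
have leave l : isSome l -> \sum_(m | q m == q l) P l m <= 1 - e ^+ 2.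
  case: l => // k _; rewrite big_mkcond big_option_sum /=.
  rewrite if_same add0r (bigD1 k)//= eqxx big1 ?addr0; last first.
    move=> m mk; case: ifPn => // /eqP /enum_val_inj /pI mk'.
    by rewrite mk' eqxx in mk.
  rewrite eq_sym (negbTE (jumpP k).1) mulr0 addr0 ler_piMr//.
  have [P00 <- _] := P0P k.
  by rewrite (bigD1 k)//= lerDl sumr_ge0.
have Y0 j : \sum_l P None l * y l j = x j.
  by rewrite big_option_sum /= mul0r add0r xpx.
have near_x j := chain_gamma_near r_bd e0 e1 P_ge0 P_sum P_supp step_meas
  step_int y01 y_step j None.
exists (chain_profile step q e None); split; last first.
  by move=> j; rewrite -Y0 (le_trans (near_x j))//; lra.
split=> [|d eta [_ eta01]].
  by apply: chain_profile_is_profile => //; rewrite !ltW.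
have := gamma_deviate_le r_bd r_diag e0 e1 P_ge0 P_sum P_supp step_meas step_supp
  step_int y01 y_step y_own leave d None eta01.
by have := near_x d; rewrite ler_norml => /andP[]; lra.
Qed.

End Assembly.

Theorem theorem5 (R : realType) (N : nat) (r : game R N) :
  game_bounded r ->
  (forall i : 'I_N, r [set i] i = 0) ->
  Mmatrix (Rhat r) ->
  forall x : 'I_N -> R, Dtilde r x -> sunspot_eq_payoff r x.
Proof.
move=> r_bd r_diag rM x xD.
have /choice[xi xiP] : forall eps : R, exists xi, 0 < eps ->
    sunspot_eps_eq r eps xi /\ forall j, `|gamma r xi j - x j| <= eps.
  (* Nothing is required for [eps <= 0], so a constant profile fills that case. *)
  move=> eps; have [eps0|] := ltP 0 eps; last by exists (fun _ _ => 0).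
  by have [xi xiP] := sunspot_approx r_bd r_diag rM xD eps0; exists xi.
exists xi; split=> [eps /xiP[]//|j].
apply/cvgrPdist_le => delta delta0; near=> eps.
have eps0 : 0 < eps by near: eps; exact: nbhs_right_gt.
rewrite distrC; apply: le_trans ((xiP _ eps0).2 j) _.
by near: eps; exact: nbhs_right_le.
Unshelve. all: by end_near. Qed.
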